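(* Every virtually cyclic group embeds as a demonstrative subgroup of Thompson's group $V$.
   Context: Let $\mathrm{Ends}(\mathcal{T}_2) = \{0,1\}^{\mathbb{N}}$ be the set of infinite binary strings with the product topology (a Cantor set). For a finite binary word $u$ let $u* = \{u\hat\omega : \hat\omega \in \mathrm{Ends}(\mathcal{T}_2)\}$. Thompson's group $V$ is the group of homeomorphisms $f$ of $\mathrm{Ends}(\mathcal{T}_2)$ for which there are finite partitions $\{u_1*,\dots,u_n*\}$ and $\{v_1*,\dots,v_n*\}$ of $\mathrm{Ends}(\mathcal{T}_2)$ such that $f(u_i\hat\omega) = v_i\hat\omega$ for all $i$ and all $\hat\omega \in \mathrm{Ends}(\mathcal{T}_2)$. A subgroup $K \le V$ is demonstrative if there is an open set $U \subseteq \mathrm{Ends}(\mathcal{T}_2)$ such that for all $h_1,h_2 \in K$, $h_1U \cap h_2U \neq \emptyset$ if and only if $h_1=h_2$. A group $K$ embeds as a demonstrative subgroup of $V$ if there is an injective homomorphism $K \to V$ whose image is a demonstrative subgroup of $V$. A group is virtually cyclic if it has a cyclic subgroup of finite index. *)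

(* Defs.v *)
From HB Require Import structures.
From mathcomp Require Import all_boot.
From mathcomp Require Import all_classical.
From mathcomp Require Import topology cantor.

Set Implicit Arguments.
Unset Strict Implicit.
Unset Printing Implicit Defensive.

Local Open Scope classical_set_scope.
Local Open Scope group_scope.

(* [groupType] imposes no finiteness; [group_closed] is the library's subgroup
   condition, namely closure under 1 and x / y. *)
Definition subgroup (G : groupType) (K : set G) : Prop := group_closed (mem K).

Definition zpowers (G : groupType) (a : G) : set G :=
  [set x | exists n : nat, x = a ^+ n \/ x = a ^- n].

Definition cyclic_set (G : groupType) (K : set G) : Prop :=
  exists a : G, K = zpowers a.

Definition left_coset (G : groupType) (K : set G) (x : G) : set G :=
  [set x * k | k in K].

Definition finite_index (G : groupType) (K : set G) : Prop :=
  finite_set (range (left_coset K)).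

Definition virtually_cyclic (G : groupType) : Prop :=
  exists K : set G, [/\ subgroup K, cyclic_set K & finite_index K].

Definition homeomorphism (f : cantor_space -> cantor_space) : Prop :=
  exists g : cantor_space -> cantor_space,
    [/\ cancel f g, cancel g f, continuous f & continuous g].

Definition homeo : Type := set_type [set f | homeomorphism f].

Definition homeo_fun (f : homeo) : cantor_space -> cantor_space := val f.
Coercion homeo_fun : homeo >-> Funclass.

HB.instance Definition _ := Choice.on homeo.

Lemma homeoP (f g : homeo) : f =1 g -> f = g.
Proof. by move=> fg; apply: val_inj; apply/funext. Qed.

Lemma homeo_homeomorphism (f : homeo) : homeomorphism f.
Proof. by have /set_mem := valP f. Qed.

Definition mk_homeo f (hf : homeomorphism f) : homeo :=
  SigSub (mem_set (hf : [set f | homeomorphism f] f)).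

Lemma homeomorphism_id : homeomorphism id.
Proof. by exists id; split=> // x; exact: cvg_id. Qed.

Lemma homeomorphism_comp (f g : homeo) : homeomorphism (f \o g).
Proof.
have [f' [fK f'K cf cf']] := homeo_homeomorphism f.
have [g' [gK g'K cg cg']] := homeo_homeomorphism g.
exists (g' \o f'); split.
- exact: can_comp.
- exact: can_comp.
- by move=> x; apply: continuous_comp; [exact: cg | exact: cf].
- by move=> x; apply: continuous_comp; [exact: cf' | exact: cg'].
Qed.

Definition inv_fun (f : homeo) : cantor_space -> cantor_space :=
  sval (cid (homeo_homeomorphism f)).

Lemma inv_funK (f : homeo) : cancel f (inv_fun f).
Proof. by rewrite /inv_fun; case: cid => g []. Qed.

Lemma inv_funKV (f : homeo) : cancel (inv_fun f) f.
Proof. by rewrite /inv_fun; case: cid => g []. Qed.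

Lemma homeomorphism_inv (f : homeo) : homeomorphism (inv_fun f).
Proof. by rewrite /inv_fun; case: cid => g [] *; exists f. Qed.

(* The product is composition, so that [homeo] acts on the left. *)
Definition homeo_one : homeo := mk_homeo homeomorphism_id.
Definition homeo_mul (f g : homeo) : homeo := mk_homeo (homeomorphism_comp f g).
Definition homeo_inv (f : homeo) : homeo := mk_homeo (homeomorphism_inv f).

Fact homeo_mulA : associative homeo_mul.
Proof. by move=> f g h; apply: homeoP. Qed.
Fact homeo_1mul : left_id homeo_one homeo_mul.
Proof. by move=> f; apply: homeoP. Qed.
Fact homeo_mul1 : right_id homeo_one homeo_mul.
Proof. by move=> f; apply: homeoP. Qed.
Fact homeo_mulV : left_inverse homeo_one homeo_inv homeo_mul.
Proof. by move=> f; apply: homeoP => x; exact: inv_funK. Qed.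
Fact homeo_Vmul : right_inverse homeo_one homeo_inv homeo_mul.
Proof. by move=> f; apply: homeoP => x; exact: inv_funKV. Qed.

HB.instance Definition _ := isGroup.Build homeo
  homeo_mulA homeo_1mul homeo_mul1 homeo_mulV homeo_Vmul.

Lemma homeo1E x : (1 : homeo) x = x. Proof. by []. Qed.
Lemma homeoME (f g : homeo) x : (f * g : homeo) x = f (g x). Proof. by []. Qed.
Lemma homeoVK (f : homeo) : cancel f (f^-1%g : homeo). Proof. exact: inv_funK. Qed.
Lemma homeoKV (f : homeo) : cancel (f^-1%g : homeo) f. Proof. exact: inv_funKV. Qed.

Definition prepend (u : seq bool) (w : cantor_space) : cantor_space :=
  fun n => if n < size u then nth false u n else w (n - size u).

Definition cone (u : seq bool) : set cantor_space := range (prepend u).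

Definition cone_partition (I : Type) (u : I -> seq bool) : Prop :=
  partition [set: I] (fun i => cone (u i)) [set: cantor_space].

Definition in_thompsonV (f : homeo) : Prop :=
  exists (n : nat) (u v : 'I_n -> seq bool),
    [/\ cone_partition u, cone_partition v &
        forall i w, f (prepend (u i) w) = prepend (v i) w].

Lemma prepend_cat u v w : prepend (u ++ v) w = prepend u (prepend v w).
Proof.
apply/funext => n; rewrite /prepend size_cat nth_cat.
case: (ltnP n (size u)) => [nu|un]; first by rewrite ltn_addr.
by rewrite ltn_subLR // subnDA.
Qed.

Lemma prepend_inj u : injective (prepend u).
Proof.
move=> w1 w2 e; apply/funext => n.
have := congr1 (fun f : cantor_space => f (n + size u)) e.
by rewrite /prepend ltnNge leq_addl /= addnK.
Qed.

Lemma prepend_meet u v x y : prepend u x = prepend v y ->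
  (exists r, v = u ++ r /\ x = prepend r y) \/
  (exists r, u = v ++ r /\ y = prepend r x).
Proof.
wlog uv : u v x y / size u <= size v => [H e|e].
  case: (leqP (size u) (size v)) => [uv|/ltnW vu]; first exact: H.
  by have [] := H _ _ _ _ vu (esym e); [right|left].
have vE : v = u ++ drop (size u) v.
  rewrite -[LHS](cat_take_drop (size u)); congr (_ ++ _).
  apply: (@eq_from_nth _ false); first by rewrite size_takel.
  move=> i; rewrite size_takel // => iu; rewrite nth_take //.
  have := congr1 (fun f : cantor_space => f i) e.
  by rewrite /prepend iu (leq_trans iu uv).
left; exists (drop (size u) v); split=> //.
by apply: (@prepend_inj u); rewrite -prepend_cat -vE.
Qed.

Lemma cone_partitionP (I : Type) (u : I -> seq bool) :
  cone_partition u <->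
  (forall x, exists i w, x = prepend (u i) w) /\
  (forall i j w w', prepend (u i) w = prepend (u j) w' -> i = j).
Proof.
split=> [[cov triv _]|[cov triv]].
  split=> [x|i j w w' e].
    have : [set: cantor_space] x by [].
    by rewrite -cov => -[i _ [w _ <-]]; exists i, w.
  by apply: triv => //; exists (prepend (u i) w); split; [exists w | exists w'].
split.
- rewrite -subTset => x _; have [i [w ->]] := cov x.
  by exists i => //; exists w.
- by move=> i j _ _ [_ [[w _ <-] [w' _ /esym]]]; exact: triv.
- by move=> i _; exists (prepend (u i) (fun=> false)); exists (fun=> false).
Qed.

Lemma in_thompsonV_fin (I : finType) (u v : I -> seq bool) (f : homeo) :
  cone_partition u -> cone_partition v ->
  (forall i w, f (prepend (u i) w) = prepend (v i) w) -> in_thompsonV f.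
Proof.
have re (t : I -> seq bool) :
    cone_partition t -> cone_partition (fun i : 'I_#|I| => t (enum_val i)).
  move=> /cone_partitionP[cov triv]; apply/cone_partitionP; split=> [x|i j w w'].
    by have [i [w ->]] := cov x; exists (enum_rank i), w; rewrite enum_rankK.
  by move=> /triv /enum_val_inj.
move=> pu pv fE; exists #|I|, (u \o enum_val), (v \o enum_val).
by split; [exact: re | exact: re | move=> i w; exact: fE].
Qed.

Lemma in_thompsonV1 : in_thompsonV 1.
Proof.
have p1 : cone_partition (fun _ : unit => [::]).
  apply/cone_partitionP; split=> [x|[] []] //.
  by exists tt, x; apply/funext => n; rewrite /prepend subn0.
exact: (in_thompsonV_fin p1 p1).
Qed.

Lemma in_thompsonVV f : in_thompsonV f -> in_thompsonV f^-1.
Proof.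
move=> [n [u [v [pu pv fE]]]]; exists n, v, u; split=> // i w.
by rewrite -fE homeoVK.
Qed.

Lemma in_thompsonVM f g : in_thompsonV f -> in_thompsonV g -> in_thompsonV (f * g).
Proof.
move=> [m [s [t [ps pt fE]]]] [n [u [v [pu pv gE]]]].
have /cone_partitionP[scov striv] := ps.
have /cone_partitionP[tcov ttriv] := pt.
have /cone_partitionP[ucov utriv] := pu.
have /cone_partitionP[vcov vtriv] := pv.
pose cmp (p : 'I_n * 'I_m) := prefix (v p.1) (s p.2) || prefix (s p.2) (v p.1).
pose I : finType := {p : 'I_n * 'I_m | cmp p}.
pose a (k : I) :=
  u (val k).1 ++ drop (size (v (val k).1)) (s (val k).2).
pose c (k : I) :=
  v (val k).1 ++ drop (size (v (val k).1)) (s (val k).2).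
pose b (k : I) :=
  t (val k).2 ++ drop (size (s (val k).2)) (v (val k).1).
have cE (k : I) :
    c k = s (val k).2 ++ drop (size (s (val k).2)) (v (val k).1).
  rewrite /c; case: k => -[i j] /= /orP[]/prefixP[r /= ->].
    by rewrite drop_size_cat // drop_oversize ?cats0 // size_cat leq_addr.
  by rewrite drop_size_cat // drop_oversize ?cats0 // size_cat leq_addr.
have gaE k w : g (prepend (a k) w) = prepend (c k) w.
  by rewrite !prepend_cat gE.
have fcE k w : f (prepend (c k) w) = prepend (b k) w.
  by rewrite cE !prepend_cat fE.
have pc : cone_partition c.
  apply/cone_partitionP; split=> [x|k l w w' e].
    have [i [y xy]] := vcov x; have [j [z xz]] := scov x.
    have [[r [sE yE]]|[r [vE zE]]] :=
      prepend_meet (etrans (esym xy) xz).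
    - have ij : cmp (i, j) by rewrite /cmp /= sE prefix_prefix.
      exists (exist _ (i, j) ij : I), z.
      by rewrite /c /= sE drop_size_cat // -sE.
    - have ij : cmp (i, j) by rewrite /cmp /= vE prefix_prefix orbT.
      exists (exist _ (i, j) ij : I), y.
      by rewrite cE /= vE drop_size_cat // -vE.
  apply: val_inj; rewrite [val k]surjective_pairing [val l]surjective_pairing.
  congr pair.
    by move: e; rewrite !prepend_cat; exact: vtriv.
  by move: e; rewrite !cE !prepend_cat; exact: striv.
have /cone_partitionP[ccov ctriv] := pc.
apply: (@in_thompsonV_fin I a b).
- apply/cone_partitionP; split=> [x|k l w w' /(congr1 g)]; last first.
    by rewrite !gaE; exact: ctriv.
  have [k [w e]] := ccov (g x); exists k, w.
  by apply: (can_inj (homeoVK g)); rewrite gaE.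
- apply/cone_partitionP; split=> [x|k l w w' ]; last first.
    by rewrite -!fcE => /(can_inj (homeoVK f)); exact: ctriv.
  have [k [w e]] := ccov ((f^-1%g : homeo) x); exists k, w.
  by apply: (can_inj (homeoKV f)); rewrite -fcE homeoVK.
- by move=> k w; rewrite homeoME gaE fcE.
Qed.

Definition thompsonV_set : set homeo := [set f | in_thompsonV f].

Lemma thompsonV_subgroup : subgroup thompsonV_set.
Proof.
split=> [|f g]; first by rewrite inE; exact: in_thompsonV1.
rewrite !inE => Vf Vg; apply: in_thompsonVM => //; exact: in_thompsonVV.
Qed.

Definition thompsonV : Type := set_type thompsonV_set.

HB.instance Definition _ := SubChoice.on thompsonV.
HB.instance Definition _ :=
  SubChoice_isSubGroup.Build homeo (mem thompsonV_set) thompsonV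
    thompsonV_subgroup.

Definition homeo_of_thompsonV (f : thompsonV) : homeo := val f.
Coercion homeo_of_thompsonV : thompsonV >-> homeo.

(* [h @` U] is the translate hU. *)
Definition demonstrative (K : set thompsonV) : Prop :=
  subgroup K /\
  exists U : set cantor_space,
    open U /\
    forall h1 h2 : thompsonV, K h1 -> K h2 ->
      ((h1 @` U) `&` (h2 @` U) !=set0 <-> h1 = h2).

Definition embeds_demonstratively (G : groupType) : Prop :=
  exists phi : {multiplicative G -> thompsonV},
    injective phi /\ demonstrative (range phi).

(* Main.v *)
From HB Require Import structures.
Require Import Defs.
From mathcomp Require Import all_boot.
From mathcomp Require Import all_classical.
From mathcomp Require Import topology cantor.
From mathcomp Require Import finmap.

(* A demonstrative action is inherited from any finite-index subgroup [K]: the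
   induced action of [G] on finitely many copies of the Cantor set, one for each
   left coset of [K], is again by elements of [V], since a Cantor set can be cut
   into any finite number of cones. A virtually cyclic group has either the
   trivial group or an infinite cyclic group as a subgroup of finite index. The
   latter acts through a single element of [V] with a wandering cone, and that
   cone witnesses that the action is demonstrative. *)

Set Implicit Arguments.
Unset Strict Implicit.
Unset Printing Implicit Defensive.

Local Open Scope classical_set_scope.
Local Open Scope group_scope.

(** * Topology of the Cantor space: coordinates, cones and maps that replace prefixes *)

Lemma near_cantor_coord (x : cantor_space) n : \forall y \near x, y n = x n.
Proof.
exact: (@proj_continuous nat (fun=> bool) n x) (discrete_set1 (x n)).
Qed.

(** The product topology is the supremum of the topologies pulled back along the coordinates, each
    with values in a discrete space. *)
Lemma cvg_cantor (F : set_system cantor_space) (x : cantor_space) :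
  Filter F -> (forall n, F [set y | y n = x n]) -> F --> x.
Proof.
move=> FF Fx; apply/cvg_sup => n A.
rewrite nbhsE => -[_ [[B _ <-] Bx] sBA].
by apply: filterS (Fx n) => y yx; apply: sBA; rewrite /preimage /= yx.
Qed.

Lemma near_cone u w : \forall y \near prepend u w, cone u y.
Proof.
have near_u := filter_forall (nbhs_filter (prepend u w))
  (fun i : 'I_(size u) => near_cantor_coord (prepend u w) i).
apply: filterS near_u => y yu; exists (fun n => y (n + size u)) => //.
apply/funext => n; rewrite /prepend; case: ltnP => [nu|un]; last first.
  by rewrite subnK.
by rewrite (yu (Ordinal nu)) /prepend nu.
Qed.

Lemma cone_map_continuous (I : Type) (u v : I -> seq bool)
    (f : cantor_space -> cantor_space) :
  cone_partition u ->
  (forall i w, f (prepend (u i) w) = prepend (v i) w) -> continuous f.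
Proof.
move=> /cone_partitionP[cov _] fE x; have [i [w ->]] := cov x.
apply: cvg_cantor => n.
have := near_cone (u i) w.
(* Output letter [n] is either a letter of [v i] or the input letter at this index. In the first
   case the truncated subtraction gives an irrelevant index. *)
have := near_cantor_coord (prepend (u i) w) (n - size (v i) + size (u i)).
apply: filterS2 => _ /[swap] -[z _ <-].
rewrite /= !fE /prepend [X in X -> _]/= ltnNge leq_addl /= addnK => wz.
by case: ifP.
Qed.

(** Every point has exactly one decomposition [prepend (u i) w], so prescriptions on the separate
    cones never conflict. *)
Lemma cone_case (I : Type) (u : I -> seq bool)
    (F : I -> cantor_space -> cantor_space) : cone_partition u ->
  exists f : cantor_space -> cantor_space,
    forall i w, f (prepend (u i) w) = F i w.
Proof.
move=> /cone_partitionP[cov triv].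
have /choice[f fE] : forall x, exists y, forall i w,
    x = prepend (u i) w -> y = F i w.
  move=> x; have [i [w ->]] := cov x; exists (F i w) => j z e.
  by have ij := triv _ _ _ _ e; rewrite -ij in e *; rewrite (prepend_inj e).
by exists f => i w; exact: fE.
Qed.

Lemma cone_map_homeomorphism (I : Type) (u v : I -> seq bool)
    (f : cantor_space -> cantor_space) :
  cone_partition u -> cone_partition v ->
  (forall i w, f (prepend (u i) w) = prepend (v i) w) -> homeomorphism f.
Proof.
move=> pu pv fE; have [g gE] := cone_case (prepend \o u) pv.
have /cone_partitionP[ucov _] := pu; have /cone_partitionP[vcov _] := pv.
exists g; split.
- by move=> x; have [i [w ->]] := ucov x; rewrite fE gE.
- by move=> x; have [i [w ->]] := vcov x; rewrite gE fE.
- exact: cone_map_continuous fE.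
- exact: cone_map_continuous gE.
Qed.

(** * Elements of V built from cone partitions *)

Lemma thompsonV_ext (f g : thompsonV) : f =1 g -> f = g.
Proof. by move=> fg; apply: val_inj; exact: homeoP. Qed.

Lemma thompsonVME (f g : thompsonV) x : (f * g : thompsonV) x = f (g x).
Proof. by []. Qed.

Lemma cone_map_thompsonV (I : finType) (u v : I -> seq bool) :
  cone_partition u -> cone_partition v ->
  exists f : thompsonV, forall i w, f (prepend (u i) w) = prepend (v i) w.
Proof.
move=> pu pv; have [f fE] := cone_case (prepend \o v) pu.
have Vf : thompsonV_set (mk_homeo (cone_map_homeomorphism pu pv fE)).
  exact: (in_thompsonV_fin pu pv).
by exists (SigSub (mem_set Vf)).
Qed.

Lemma prepend_head (x : cantor_space) :
  x = prepend [:: x 0] (fun n => x n.+1).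
Proof. by apply/funext => -[|n] //; rewrite /prepend /= subn1. Qed.

Lemma cone_partition_bij (I J : Type) (s : J -> I) (u : I -> seq bool) :
  bijective s -> cone_partition u -> cone_partition (u \o s).
Proof.
move=> [t sK tK] /cone_partitionP[cov triv]; apply/cone_partitionP; split.
  by move=> x; have [i [w ->]] := cov x; exists (t i), w; rewrite /= tK.
by move=> i j w w' /triv /(can_inj sK).
Qed.

Lemma cone_partition_cat (I : Type) (J : I -> Type) (c : I -> seq bool)
    (p : forall i, J i -> seq bool) :
  cone_partition c -> (forall i, cone_partition (p i)) ->
  cone_partition (fun k : {i : I & J i} => c (tag k) ++ p _ (tagged k)).
Proof.
move=> /cone_partitionP[cov triv] pp; apply/cone_partitionP; split=> [x|].
  have [i [y ->]] := cov x; have /cone_partitionP[pcov _] := pp i.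
  by have [j [w ->]] := pcov y; exists (Tagged J j), w; rewrite prepend_cat.
move=> [i j] [k l] w w'; rewrite !prepend_cat /= => e.
have ik := triv _ _ _ _ e; move: l e; rewrite -ik => l /prepend_inj.
by have /cone_partitionP[_ ptriv] := pp i; move/ptriv ->.
Qed.

(** Splitting off the cone of 0 and recursing inside the cone of 1 yields the words 0, 10, 110, and
    so on, closed by a word of ones only. *)
Lemma exists_cone_partition n :
  exists c : 'I_n.+1 -> seq bool, cone_partition c.
Proof.
elim: n => [|n [c /cone_partitionP[cov triv]]].
  exists (fun=> [::]); apply/cone_partitionP; split=> [x|i j _ _ _].
    by exists ord0, x; apply/funext => n; rewrite /prepend subn0.
  by rewrite !ord1.
exists (fun i => if unlift ord0 i is Some j then true :: c j else [:: false]).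
apply/cone_partitionP; split=> [x|i j w w'].
  have := prepend_head x; set y : cantor_space := fun n => _.
  case: (x 0) => ->; last by exists ord0, y; rewrite unlift_none.
  have [j [w ->]] := cov y; exists (lift ord0 j), w.
  by rewrite liftK -prepend_cat.
case: unliftP => [k|] ->; case: unliftP => [l|] ->.
- rewrite -cat1s -[true :: c l]cat1s !prepend_cat => /prepend_inj /triv.
  by move->.
- by move/(congr1 (fun f : cantor_space => f 0)).
- by move/(congr1 (fun f : cantor_space => f 0)).
- by [].
Qed.

(** Refining each cone [c i] by a domain partition of [r i], and [c (s i)] by the matching range
    partition, exhibits the map as a prefix replacement. *)
Lemma thompsonV_wreath (I : finType) (c : I -> seq bool) (s : I -> I)
    (r : I -> thompsonV) :
  cone_partition c -> bijective s ->
  exists h : thompsonV, forall i w,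
    h (prepend (c i) w) = prepend (c (s i)) (r i w).
Proof.
move=> pc bs.
pose Q i (k : {n & ('I_n -> seq bool) * ('I_n -> seq bool)}%type) :=
  [/\ cone_partition (tagged k).1, cone_partition (tagged k).2 &
  forall j w, r i (prepend ((tagged k).1 j) w) = prepend ((tagged k).2 j) w].
have /choice[k kP] : forall i, exists k, Q i k.
  move=> i; have /set_mem[n [u [v uvP]]] := valP (r i).
  by exists (existT _ n (u, v)).
pose J i := 'I_(tag (k i)).
pose p i : J i -> seq bool := (tagged (k i)).1.
pose q i : J i -> seq bool := (tagged (k i)).2.
have pp : forall i, cone_partition (p i) by move=> i; have [] := kP i.
have pq : forall i, cone_partition (q i) by move=> i; have [] := kP i.
have rE i : forall j w, r i (prepend (p i j) w) = prepend (q i j) w.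
  by have [] := kP i.
have [||h hE] := @cone_map_thompsonV {i & J i}
    (fun a => c (tag a) ++ p _ (tagged a))
    (fun a => c (s (tag a)) ++ q _ (tagged a)).
- exact: cone_partition_cat pc pp.
- exact: (cone_partition_cat (cone_partition_bij bs pc) pq).
- exists h => i w; have /cone_partitionP[pcov _] := pp i.
  have [j [z ->]] := pcov w; rewrite rE -!prepend_cat.
  exact: (hE (Tagged J j)).
Qed.

(** Deleting the first [size u] letters is a continuous left inverse of [prepend u], and a cone is a
    neighbourhood of each of its points. *)
Lemma open_prepend u (U : set cantor_space) : open U -> open (prepend u @` U).
Proof.
rewrite !openE => oU _ [w Uw <-].
pose shift (y : cantor_space) : cantor_space := fun n => y (n + size u).
have shiftK z : shift (prepend u z) = z.
  by apply/funext => n; rewrite /shift /prepend ltnNge leq_addl /= addnK.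
have : shift @ prepend u w --> w.
  apply: cvg_cantor => n.
  apply: filterS (near_cantor_coord (prepend u w) (n + size u)) => y yw.
  by have <- : shift (prepend u w) n = w n by rewrite shiftK.
move=> /(_ _ (oU _ Uw)) near_U.
rewrite nbhs_simpl /= in near_U.
apply: filterS2 near_U (near_cone u w) => _ /[swap] -[z _ <-].
by rewrite /= shiftK => Uz; exists z.
Qed.

(** * Finite-index subgroups and induced actions *)

Lemma left_transversal (G : groupType) (K : set G) :
  subgroup K -> finite_index K ->
  exists (I : finType) (t : I -> G) (idx : G -> I),
    (forall g, K ((t (idx g))^-1 * g)) /\
    (forall i k, K k -> idx (t i * k) = i).
Proof.
move=> sK /finite_fsetP[X XE].
have K1 : K 1 by apply: set_mem; case: sK.
have KM x y : K x -> K y -> K (x * y).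
  by move=> Kx Ky; apply: set_mem; apply: (group_closedM sK); exact: mem_set.
have KV x : K x -> K x^-1.
  by move=> Kx; apply: set_mem; apply: (group_closedV sK); exact: mem_set.
have inX g : (left_coset K g \in X).
  have : range (left_coset K) (left_coset K g) by exists g.
  by rewrite XE.
have /choice[t tE] : forall i : X, exists g, left_coset K g = val i.
  move=> i; have : [set` X] (val i) by exact: valP.
  by rewrite -XE => -[g _ <-]; exists g.
exists X, t, (fun g => [` inX g]%fset); split=> [g|i k Kk].
  have : left_coset K (t [` inX g]%fset) g.
    by rewrite tE; exists 1 => //; rewrite mulg1.
  by move=> [k Kk kg]; rewrite -[X in _ * X]kg mulKg.
apply: val_inj; rewrite /= -tE; apply/seteqP; split=> _ [l Kl <-].
  by exists (k * l); [exact: KM|rewrite mulgA].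
by exists (k^-1 * l); [apply: KM => //; exact: KV | rewrite -mulgA mulVKg].
Qed.

(* The induced action of [G] on [G *_K C]: each copy of the Cantor space, one
   for every left coset of [K], is realised as a cone, and [g] sends the cone of
   [t i] to that of [t j], acting there through [(t j)^-1 * g * t i] in [K]. *)
Lemma demonstrative_induction (G : groupType) (K : set G)
    (rho : G -> thompsonV) (U : set cantor_space) :
  subgroup K -> finite_index K ->
  (forall x y, K x -> K y -> rho (x * y) = rho x * rho y) ->
  open U -> U !=set0 ->
  (forall k, K k -> (rho k @` U) `&` U !=set0 -> k = 1) ->
  embeds_demonstratively G.
Proof.
move=> sK fK rhoM oU [w0 Uw0] rhoU.
have [I [t [idx [tK idxK]]]] := left_transversal sK fK.
have KM x y : K x -> K y -> K (x * y).
  by move=> Kx Ky; apply: set_mem; apply: (group_closedM sK); exact: mem_set.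
have idxM g k : K k -> idx (g * k) = idx g.
  move=> Kk; rewrite -[g in LHS](mulVKg (t (idx g))) -mulgA.
  by apply: idxK; apply: KM.
have [c pc] : exists c : I -> seq bool, cone_partition c.
  have I0 : 0 < #|I| by apply/card_gt0P; exists (idx 1).
  have [c pc] := exists_cone_partition #|I|.-1.
  exists (c \o cast_ord (esym (prednK I0)) \o enum_rank).
  apply: cone_partition_bij (cone_partition_bij _ pc).
    exact: enum_rank_bij.
  exact: (Bijective (cast_ordK _) (cast_ordKV _)).
have /cone_partitionP[ccov ctriv] := pc.
pose s g i := idx (g * t i).
have sM g h i : s (g * h) i = s g (s h i).
  rewrite /s -mulgA -[in LHS](mulVKg (t (idx (h * t i))) (h * t i)).
  by rewrite [g * (t _ * _)]mulgA; exact: idxM.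
have s1 i : s 1 i = i.
  by rewrite /s mul1g -[t i]mulg1 idxK //; apply: set_mem; case: sK.
have sbij g : bijective (s g).
  by exists (s g^-1) => i; rewrite -sM ?mulVg ?mulgV s1.
pose r g i := (t (s g i))^-1 * (g * t i).
have Kr g i : K (r g i) by exact: tK.
(* The cocycle identity: [t (s h i)] and its inverse cancel between the two factors. With [rhoM] it
   makes [phi] multiplicative. *)
have rM g h i : r (g * h) i = r g (s h i) * r h i.
  by rewrite /r sM !mulgA mulgK.
have /choice[phi phiE] : forall g, exists f : thompsonV, forall i w,
    f (prepend (c i) w) = prepend (c (s g i)) (rho (r g i) w).
  by move=> g; exact: (thompsonV_wreath (fun i => rho (r g i)) pc (sbij g)).
have phiM : {morph phi : g h / g * h}.
  move=> g h; apply: thompsonV_ext => x; have [i [w ->]] := ccov x.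
  by rewrite thompsonVME !phiE sM rM rhoM.
pose i0 := idx 1; pose V := prepend (c i0) @` U.
(* Translating by the inverse of [phi h], the element [h^-1 * g] moves a point of [V] into [V].
   Hence it fixes the index [i0], and its conjugate [r (h^-1 * g) i0] is 1 by [rhoU]. *)
have phiV g h : (phi g @` V) `&` (phi h @` V) !=set0 -> g = h.
  move=> [_ [[_ [w Uw <-] <-] [_ [z Uz <-] zw]]].
  have /esym : phi (h^-1 * g) (prepend (c i0) w) = prepend (c i0) z.
    by apply: (can_inj (homeoVK (phi h))); rewrite zw -thompsonVME -phiM mulVKg.
  rewrite phiE => e; have si0 := ctriv _ _ _ _ e.
  move: e; rewrite -si0 => /prepend_inj e.
  have : r (h^-1 * g) i0 = 1.
    by apply: rhoU; [exact: Kr | exists z; split=> //; exists w].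
  rewrite /r -si0 => e1; apply: (mulgI h^-1); rewrite mulVg.
  by rewrite -[LHS](mulgK (t i0)) -[_ * t i0](mulVKg (t i0)) e1 mulg1 mulgV.
have phi_meet g : (phi g @` V) `&` (phi g @` V) !=set0.
  rewrite setIid; exists (phi g (prepend (c i0) w0)).
  by exists (prepend (c i0) w0) => //; exists w0.
pose phi_mul := isMultiplicative.Build G thompsonV phi phiM.
pose phiH : {multiplicative G -> thompsonV} := HB.pack phi phi_mul.
have phi1 : phi 1 = 1 by apply: (mulgI (phi 1)); rewrite -phiM !mulg1.
have phiVg g : phi g^-1 = (phi g)^-1.
  by apply: (mulgI (phi g)); rewrite -phiM !mulgV.
exists phiH; split=> [g h /= e|].
  by apply: phiV; rewrite e; exact: phi_meet.
split.
  split=> [|_ _ /set_mem[g _ <-] /set_mem[h _ <-]]; apply: mem_set.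
    by exists 1.
  by exists (g / h) => //=; rewrite phiM phiVg.
exists V; split; first exact: open_prepend.
move=> _ _ [g _ <-] [h _ <-] /=; split=> [/phiV -> //|->]; exact: phi_meet.
Qed.

(** * An element of V with a wandering cone *)

(** Both sides of the wandering element come from this family: [false] gives the words 00, 01, 1 and
    [true] gives 10, 11, 0. *)
Lemma cone_partition_split (b : bool) :
  cone_partition (fun o => if o is Some d then [:: b; d] else [:: ~~ b]).
Proof.
apply/cone_partitionP; split=> [x|].
  have := prepend_head x; have [->|nb] := eqVneq (x 0) b.
    rewrite (prepend_head (fun n => x n.+1)) -prepend_cat => ->.
    by exists (Some (x 1%N)); eexists.
  have -> : x 0 = ~~ b by case: (x 0) b nb => [] [].
  by move=> ->; exists None; eexists.
move=> i j w w' e.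
have := congr1 (fun f : cantor_space => f 0) e.
have := congr1 (fun f : cantor_space => f 1%N) e.
case: i j {e} => [i|] [j|]; rewrite /prepend /=.
- by move=> ->.
- by move=> _; case: b.
- by move=> _; case: b.
- by [].
Qed.

(* [f] maps 1w to 11w, 01w to 10w and 00w to 0w: it fixes 0^oo and 1^oo and sends
   each of the cones ..., 001*, 01*, 10*, 110*, ... to the next one. *)
Lemma exists_wandering :
  exists (f : thompsonV) (U : set cantor_space), [/\ open U, U !=set0 &
    forall n, 0 < n -> ~ (((f ^+ n : thompsonV) @` U) `&` U !=set0)].
Proof.
pose s (o : option bool) :=
  if o is Some d then if d then Some false else None else Some true.
have bs : bijective s.
  exists (fun o => if o is Some d then if d then None else Some true
                   else Some false); by case=> [[]|].
have [f fE] := cone_map_thompsonV (cone_partition_split false)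
  (cone_partition_bij bs (cone_partition_split true)).
have f1 w : f (prepend [:: true] w) = prepend [:: true; true] w.
  exact: (fE None).
(* Every positive power sends the cone of 1 into that of 11, which is disjoint from the cone of 10
   chosen as [U]. *)
have fX n w : exists z, (f ^+ n.+1 : thompsonV) (prepend [:: true] w) =
    prepend [:: true; true] z.
  elim: n w => [|n IHn] w; first by exists w; rewrite expg1 f1.
  by rewrite expgSr thompsonVME f1 -cat1s prepend_cat; exact: IHn.
exists f, (cone [:: true; false]); split=> [||[|n] // _ [x [[y [w _ <-]]]]].
- exact: (open_prepend [:: true; false] openT).
- by exists (prepend [:: true; false] (fun=> false)); eexists.
- rewrite -cat1s prepend_cat; have [z ->] := fX n (prepend [:: false] w).
  by move=> <- [t _] /(congr1 (fun x : cantor_space => x 1%N)).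
Qed.

(** * Integer powers and elements of finite order *)

Section IntegerPowers.

Variable G : groupType.
Implicit Types (a : G) (n m p q : nat).

(** The quotient [a ^+ n / a ^+ m] encodes the integer exponent n - m, which avoids case
    distinctions on signs. *)
Lemma expg_divM a n m p q :
  (a ^+ n / a ^+ m) * (a ^+ p / a ^+ q) = a ^+ (n + p) / a ^+ (m + q).
Proof.
have c : commute (a ^- m) (a ^+ p) by apply/commute_sym/commuteV/commuteX2.
by rewrite -mulgA [a ^- m * _]mulgA c -!mulgA -invgM mulgA -!expgnDr (addnC q).
Qed.

Lemma expg_div_eq a n m p q :
  a ^+ n / a ^+ m = a ^+ p / a ^+ q <-> a ^+ (n + q) = a ^+ (p + m).
Proof.
have E i j k : a ^+ i / a ^+ j * a ^+ (j + k) = a ^+ (i + k).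
  by rewrite !expgnDr mulgA mulgVK.
split=> [e|e]; first by rewrite -(E n m q) e (addnC m q) E.
by apply: (mulIg (a ^+ (m + q))); rewrite E e (addnC m q) E.
Qed.

Lemma expg_div_neg a n m : n <= m -> a ^+ n / a ^+ m = a ^- (m - n).
Proof. by move=> nm; rewrite expgnFr // invgM invgK. Qed.

Lemma expg_injective a : (forall n, 0 < n -> a ^+ n <> 1) ->
  injective (fun n => a ^+ n).
Proof.
move=> a_inf.
suff H n m : n <= m -> a ^+ n = a ^+ m -> n = m.
  by move=> n m e; case/orP: (leq_total n m) => /H; [exact | move->].
move=> nm e; apply/eqP; rewrite eqn_leq nm -subn_eq0; case: posnP => // mn.
by case: (a_inf _ mn); rewrite expgnFr // e mulgV.
Qed.

Lemma finite_zpowers a n : 0 < n -> a ^+ n = 1 -> finite_set (zpowers a).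
Proof.
move=> n0 an.
have apos k : ((fun i => a ^+ i) @` `I_n) (a ^+ k).
  exists (k %% n); first exact: ltn_pmod.
  by rewrite [in RHS](divn_eq k n) mulnC expgnDr expgnA an expg1n mul1g.
apply: sub_finite_set (finite_image (fun i => a ^+ i) (finite_II n)).
move=> _ [k [->|->]]; first exact: apos.
suff -> : a ^- k = a ^+ (k * n.-1)%N by exact: apos.
apply: (mulgI (a ^+ k)); rewrite mulgV -expgnDr -mulnS prednK // mulnC.
by rewrite expgnA an expg1n.
Qed.

(** [G] is a union of finitely many finite cosets of [K], hence finite. *)
Lemma finite_index_trivial (K : set G) :
  subgroup K -> finite_set K -> finite_index K -> finite_index [set (1 : G)].
Proof.
move=> sK finK fiK; apply: finite_image.
suff : finite_set (\bigcup_(c in range (left_coset K)) c).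
  apply: sub_finite_set => g _; exists (left_coset K g); first by exists g.
  by exists 1; [apply: set_mem; case: sK | rewrite mulg1].
by apply: bigcup_finite => // _ [x _ <-]; exact: finite_image.
Qed.

End IntegerPowers.

(** * Virtually cyclic groups *)

Lemma zpowersP (G : groupType) (a x : G) :
  zpowers a x -> exists n m, x = a ^+ n / a ^+ m.
Proof.
move=> [n [->|->]]; first by exists n, 0; rewrite expg0 divg1.
by exists 0, n; rewrite expg0 mul1g.
Qed.

Theorem mainTheorem3 (G : groupType) (hG : virtually_cyclic G) :
  embeds_demonstratively G.
Proof.
have [K [sK [a KE] fK]] := hG.
have [[n [n0 an]]|a_inf] := pselect (exists n, 0 < n /\ a ^+ n = 1).
  have finK : finite_set K by rewrite KE; exact: finite_zpowers an.
  (* If [a] has finite order, then [G] is finite, and inducing from the trivial group lets [G]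
     permute the cones of a partition indexed by [G]. *)
  apply: (@demonstrative_induction G [set 1] (fun=> 1) setT) => //.
  - split=> [|_ _ /set_mem -> /set_mem ->]; apply: mem_set => //=.
    by rewrite mulgV.
  - exact: finite_index_trivial finK fK.
  - by move=> *; rewrite mulg1.
  - exact: openT.
  - by exists (fun=> false).
have aI : injective (fun n => a ^+ n).
  by apply: expg_injective => n n0 an; apply: a_inf; exists n.
have [f [U [oU U0 fU]]] := exists_wandering.
(* On [K], [rho] sends a power of [a] to the same power of [f]; its value elsewhere is arbitrary.
   Injectivity of [aI] makes the exponent difference unique, whence multiplicativity. *)
have /choice[rho rhoE] : forall x, exists h, K x ->
    exists n m, x = a ^+ n / a ^+ m /\ h = f ^+ n / f ^+ m.
  move=> x; have [Kx|nKx] := pselect (K x); last by exists 1.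
  move: Kx; rewrite KE => /zpowersP[n [m ->]].
  by exists (f ^+ n / f ^+ m) => _; exists n, m.
have KM x y : K x -> K y -> K (x * y).
  by move=> Kx Ky; apply: set_mem; apply: (group_closedM sK); exact: mem_set.
apply: (demonstrative_induction (rho := rho) sK fK _ oU U0) => [x y Kx Ky|k Kk].
  have [n [m [xE ->]]] := rhoE _ Kx; have [p [q [yE ->]]] := rhoE _ Ky.
  have [i [j [xyE ->]]] := rhoE _ (KM _ _ Kx Ky).
  move: xyE; rewrite xE yE !expg_divM => /expg_div_eq /aI e.
  by apply/expg_div_eq; rewrite e.
have [n [m [-> ->]]] := rhoE _ Kk.
case: (ltngtP n m) => [nm|mn|-> _]; last by rewrite mulgV.
  (* For a negative exponent, applying the opposite power of [f] turns the intersection into one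
     excluded by [fU]. *)
  rewrite (expg_div_neg f) ?(ltnW nm) // => -[_ [[x Ux <-] Uy]].
  have [] := fU (m - n); first by rewrite subn_gt0.
  exists x; split=> //; exists ((f ^- (m - n) : thompsonV) x) => //.
  by rewrite -thompsonVME mulgV.
rewrite -(expgnFr f) ?(ltnW mn) // => meet.
by have [] := fU (n - m); first by rewrite subn_gt0.
Qed.
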